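(* Let $\mathbb{T}\subset\mathbb{R}$, let $(\Omega,\mathcal{F}_\infty,(\mathcal{F}_t)_{t\in\mathbb{T}},\mathbb{P})$ be a filtered probability space, and let $\tau:\Omega\to\mathbb{T}\cup\{+\infty\}$ be a stopping time with stopping time $\sigma$-algebra $\mathcal{F}_\tau$. Let $\mathcal{A}(\mathcal{F}_\tau)$ be the set of minimal elements of $\mathcal{F}_\tau$, and let $$\mathcal{A}_\tau=\bigcup_{t\in\mathbb{T}\cup\{+\infty\}}\{A\in\mathcal{A}(\mathcal{F}_t): A\subset\{\tau=t\}\}.$$ Then: 1. The elements of $\mathcal{A}_\tau$ are minimal elements of $\mathcal{F}_\tau$, i.e. $\mathcal{A}_\tau\subset\mathcal{A}(\mathcal{F}_\tau)$. 2. If $|\mathcal{F}_\infty|<+\infty$, then $\mathcal{A}_\tau$ is the set of all minimal elements of $\mathcal{F}_\tau$, i.e. $\mathcal{A}_\tau=\mathcal{A}(\mathcal{F}_\tau)$, and $\mathcal{F}_\tau=\sigma(\mathcal{A}_\tau)=\sigma(\mathcal{A}(\mathcal{F}_\tau))$.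
   Context: The time axis $\mathbb{T}$ is a subset of $\mathbb{R}$. In the filtered probability space, $(\Omega,\mathcal{F}_\infty,\mathbb{P})$ is a probability space and $(\mathcal{F}_t)_{t\in\mathbb{T}}$ is a family of $\sigma$-algebras on $\Omega$ with $\mathcal{F}_s\subset\mathcal{F}_t\subset\mathcal{F}_\infty$ for all $s\le t$ in $\mathbb{T}$. The symbol $\subset$ allows equality. A stopping time is a map $\tau:\Omega\to\mathbb{T}\cup\{+\infty\}$ with $\{\tau\le t\}\in\mathcal{F}_t$ for all $t\in\mathbb{T}$. The stopping time $\sigma$-algebra with respect to $\tau$ is $$\mathcal{F}_\tau=\{F\in\mathcal{F}_\infty: F\cap\{\tau\le t\}\in\mathcal{F}_t \text{ for all } t\in\mathbb{T}\}.$$ For a $\sigma$-algebra $\mathcal{F}$ on $\Omega$, the set of minimal elements (atoms) of $\mathcal{F}$ is $$\mathcal{A}(\mathcal{F})=\{A\in\mathcal{F}: A\ne\emptyset,\text{ and if } F\in\mathcal{F},\ F\neq\emptyset \text{ and } F\subset A,\text{ then } F=A\}.$$ For a collection $\mathcal{C}$ of subsets of $\Omega$, $\sigma(\mathcal{C})$ denotes the $\sigma$-algebra on $\Omega$ generated by $\mathcal{C}$. *)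

(* Defs.v *)
From HB Require Import structures.
From mathcomp Require Import all_boot all_order all_algebra.
From mathcomp Require Import all_classical all_reals all_analysis.

Set Implicit Arguments.
Unset Strict Implicit.
Unset Printing Implicit Defensive.

Import Order.TTheory GRing.Theory Num.Theory.
Local Open Scope classical_set_scope.
Local Open Scope ring_scope.

Definition extended_time (R : realType) (T : set R) : set (\bar R) :=
  [set t%:E | t in T] `|` [set +oo%E].

(* The terminal sigma-algebra F_oo is the one carried by the measurableType
   Omega.  The values of F outside the time axis T are never constrained and
   never used. *)
Definition is_filtration (R : realType) (T : set R) (d : measure_display)
    (Omega : measurableType d) (F : R -> set (set Omega)) : Prop :=
  [/\ forall t, T t -> sigma_algebra setT (F t),
      forall t, T t -> F t `<=` @measurable d Omega &
      forall s t, T s -> T t -> s <= t -> F s `<=` F t].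

(* The value at -oo is junk: -oo does not belong to extended_time T. *)
Definition extended_filtration (R : realType) (d : measure_display)
    (Omega : measurableType d) (F : R -> set (set Omega)) (t : \bar R) :
    set (set Omega) :=
  match t with
  | r%:E => F r
  | +oo => @measurable d Omega
  | -oo => set0
  end%E.

Definition is_stopping_time (R : realType) (T : set R) (d : measure_display)
    (Omega : measurableType d) (F : R -> set (set Omega))
    (tau : Omega -> \bar R) : Prop :=
  (forall w, extended_time T (tau w)) /\
  (forall t, T t -> F t [set w | (tau w <= t%:E)%E]).

Definition stopping_sigma_algebra (R : realType) (T : set R)
    (d : measure_display) (Omega : measurableType d)
    (F : R -> set (set Omega)) (tau : Omega -> \bar R) : set (set Omega) :=
  [set A | measurable A /\
           forall t, T t -> F t (A `&` [set w | (tau w <= t%:E)%E])].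

(* Atoms in the order-theoretic sense; no measure is involved. *)
Definition minimal_elements (Omega : Type) (G : set (set Omega)) :
    set (set Omega) :=
  [set A | [/\ G A, A <> set0 &
            forall B, G B -> B <> set0 -> B `<=` A -> B = A]].

Definition stopping_atoms (R : realType) (T : set R) (d : measure_display)
    (Omega : measurableType d) (F : R -> set (set Omega))
    (tau : Omega -> \bar R) : set (set Omega) :=
  \bigcup_(t in extended_time T)
    [set A | minimal_elements (extended_filtration F t) A /\
             A `<=` [set w | tau w = t]].

(* Main.v *)
(* An atom of F_t inside {tau = t} is an atom of F_tau because F_t and F_tau
   have the same members inside {tau = t}.  When F_oo is finite, F_t is closed
   under the possibly uncountable union of the {tau <= s} with s < t, so
   {tau = t} belongs to F_t; an atom of F_tau therefore lies in a single level
   set {tau = t}.  A finite sigma-algebra is generated by its atoms. *)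

Require Import Defs.
From HB Require Import structures.
From mathcomp Require Import all_boot all_order all_algebra.
From mathcomp Require Import all_classical all_reals all_analysis.

Set Implicit Arguments.
Unset Strict Implicit.
Unset Printing Implicit Defensive.

Import Order.TTheory GRing.Theory Num.Theory.
Local Open Scope classical_set_scope.
Local Open Scope ring_scope.

Lemma sigma_algebra_countable_bigcup (X : Type) (G C : set (set X)) :
  sigma_algebra setT G -> countable C -> C `<=` G -> G (\bigcup_(A in C) A).
Proof.
(* A countable family is empty or is the image of a surjection from [nat]; the second case is the
   sequence form of closure under unions. *)
move=> [G0 _ GU] /pfcard_geP[->|[f]] CG; first by rewrite bigcup_set0.
rewrite -(image_eq f) bigcup_image; apply: GU => n; apply: CG.
exact: (@funS _ _ setT C f n I).
Qed.

Lemma sigma_algebra_finite_bigcup (X : Type) (G C : set (set X)) :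
  sigma_algebra setT G -> finite_set G -> C `<=` G -> G (\bigcup_(A in C) A).
Proof.
move=> sG finG CG; apply: sigma_algebra_countable_bigcup => //.
exact/finite_set_countable/(sub_finite_set CG).
Qed.

Lemma sigma_algebra_set_ops (X : Type) (G : set (set X)) :
  sigma_algebra setT G -> [/\ G setT, setI_closed G, setC_closed G &
    setD_closed G].
Proof.
move=> sG; have [GT _ _ GI] := (sigma_algebraP (fun A _ => @subsetT _ A)).1 sG.
have GC A : G A -> G (~` A) by rewrite -setTD; case: sG => _ + _; apply.
by split=> // A B GA GB; rewrite setDE; apply: GI => //; exact: GC.
Qed.

(** The atom is obtained from [B] by removing [N], the union of all members of [G] that miss [w].
    Finiteness of [G] keeps [N] in [G]. *)
Lemma minimal_element_through (X : Type) (G : set (set X)) (B : set X) (w : X) :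
  sigma_algebra setT G -> finite_set G -> G B -> B w ->
  exists A, [/\ minimal_elements G A, A `<=` B & A w].
Proof.
move=> sG finG GB Bw; have [_ _ GC GD] := sigma_algebra_set_ops sG.
pose N := \bigcup_(C in [set C | G C /\ ~ C w]) C.
have GN : G N by apply: sigma_algebra_finite_bigcup => // C [].
have ABw : (B `\` N) w by split=> // -[C [_ Cw]] /Cw.
exists (B `\` N); split=> //; split; first exact: GD.
  by move=> A0; rewrite A0 in ABw.
move=> C GC' /eqP/set0P[x Cx] CBN.
(* A member that misses [w] lies in [N], so a nonempty one cannot fit inside [B] minus [N]. *)
have Cw : C w.
  by apply: contrapT => nCw; have [_] := CBN x Cx; apply; exists C.
(* Since [C] contains [w], its complement misses [w] and is absorbed by [N]; hence no point outside
   [N] escapes [C]. *)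
apply/seteqP; split=> // y [_ nNy]; apply: contrapT => nCy.
by apply: nNy; exists (~` C) => //; split; [exact: GC|exact].
Qed.

(** Through each point of a member [B] passes an atom contained in [B], so [B] is a finite union of
    atoms. *)
Lemma finite_sigma_algebra_atoms (X : Type) (G : set (set X)) :
  sigma_algebra setT G -> finite_set G -> G = <<s minimal_elements G >>.
Proof.
move=> sG finG; apply/seteqP; split=> [B GB|]; last first.
  by apply: smallest_sub => // A [].
pose C := [set A | minimal_elements G A /\ A `<=` B].
have -> : B = \bigcup_(A in C) A.
  apply/seteqP; split=> [w Bw|w [A [_ AB] /AB //]].
  by have [A [mA AB Aw]] := minimal_element_through sG finG GB Bw; exists A.
have CG : C `<=` G by move=> A [[]].
apply: sigma_algebra_countable_bigcup; first exact: smallest_sigma_algebra.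
  exact/finite_set_countable/(sub_finite_set CG).
by move=> A [mA _]; exact: sub_sigma_algebra.
Qed.

Lemma stopping_sigma_algebraP (R : realType) (T : set R) (d : measure_display)
    (Omega : measurableType d) (F : R -> set (set Omega))
    (tau : Omega -> \bar R) :
  is_filtration T F -> is_stopping_time T F tau ->
  sigma_algebra setT (stopping_sigma_algebra T F tau).
Proof.
move=> [sF _ _] [_ Ftau]; split.
- split=> // t Tt; rewrite set0I; by case: (sF t Tt).
- move=> A [mA FA]; split=> [|t Tt]; first exact: measurableD.
  have [_ _ _ FD] := sigma_algebra_set_ops (sF t Tt).
  (* The trace of the complement on [{tau <= t}] is a difference of two members of [F t], the first
     one by the stopping time property. *)
  rewrite (_ : _ `&` _ = [set w | (tau w <= t%:E)%E] `\`
      (A `&` [set w | (tau w <= t%:E)%E])); last first.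
    by rewrite setDIr setDv setU0 setTD setIC.
  by apply: FD; [exact: Ftau|exact: FA].
- move=> A FA; split=> [|t Tt].
    by apply: bigcup_measurable => k _; case: (FA k).
  rewrite setI_bigcupl; have [_ _] := sF t Tt; apply=> k.
  by case: (FA k) => _; exact.
Qed.

(** For [A] inside [{tau = t}], the trace on [{tau <= s}] is [A] if [t <= s] and empty if [s < t].
    The first case is settled by monotonicity of the filtration. *)
Lemma stopping_sigma_algebra_level (R : realType) (T : set R)
    (d : measure_display) (Omega : measurableType d)
    (F : R -> set (set Omega)) (tau : Omega -> \bar R) (t : \bar R)
    (A : set Omega) :
  is_filtration T F -> extended_time T t -> A `<=` [set w | tau w = t] ->
  stopping_sigma_algebra T F tau A <-> extended_filtration F t A.
Proof.
move=> [sF FM Fmono] Tt At; split.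
  case: Tt At => [[r Tr <-]|->] At [mA FA] //=.
  have := FA r Tr; rewrite setIidl // => w /At /= ->; exact: lexx.
move=> FtA; split=> [|s Ts].
  by case: Tt FtA {At} => [[r Tr <-]|->] //=; exact: FM.
have [ts|st] := leP t s%:E.
  rewrite setIidl => [|w /At /= -> //].
  case: Tt ts FtA {At} => [[r Tr <-]|->] //=.
  by rewrite lee_fin => rs; exact: Fmono.
rewrite (_ : A `&` _ = set0); first by case: (sF s Ts).
by apply/seteqP; split=> // w [/At /= ->]; rewrite leNgt st.
Qed.

Lemma extended_filtration_level (R : realType) (T : set R)
    (d : measure_display) (Omega : measurableType d)
    (F : R -> set (set Omega)) (tau : Omega -> \bar R) (t : \bar R) :
  is_filtration T F -> is_stopping_time T F tau -> extended_time T t ->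
  finite_set (@measurable d Omega) ->
  extended_filtration F t [set w | tau w = t].
Proof.
move=> [sF FM Fmono] [Ttau Ftau] Tt finM.
have sG : sigma_algebra setT (extended_filtration F t).
  case: Tt => [[r Tr <-]|->]; first exact: sF.
  by split=> [|A|A]; [exact: measurable0|exact: measurableD|
    exact: bigcupT_measurable].
have finG : finite_set (extended_filtration F t).
  apply: sub_finite_set finM; case: Tt {sG} => [[r Tr <-]|->] //=; exact: FM.
have [GT _ _ GD] := sigma_algebra_set_ops sG.
(* The union is taken over the sets themselves, not over the times [s]: there may be uncountably
   many times, but only finitely many distinct sets. *)
pose C := [set [set w | (tau w <= s%:E)%E] | s in [set s | T s /\ (s%:E < t)%E]].
have GC : extended_filtration F t (\bigcup_(A in C) A).
  apply: sigma_algebra_finite_bigcup => // _ [s [Ts st] <-].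
  case: Tt st {sG finG GT GD C} => [[r Tr <-]|->] /=.
    by rewrite lte_fin => /ltW sr; apply: Fmono sr _ _ => //; exact: Ftau.
  by move=> _; apply: (FM s) => //; exact: Ftau.
have -> : [set w | tau w = t] = [set w | (tau w <= t)%E] `\` \bigcup_(A in C) A.
  apply/seteqP; split=> w /=.
    move=> tauw; rewrite tauw; split=> // -[_ [s [_ st] <-]] /=.
    by rewrite tauw leNgt st.
  move=> [wt nC]; apply/eqP; rewrite eq_le wt leNgt; apply/negP => tauwt.
  (* A value of [tau] strictly below [t] is not [+oo], hence is a time [s] in [T], and this [s]
     witnesses that [w] lies in the removed union. *)
  have [[s Ts sE]|wE] := Ttau w; last first.
    by move: tauwt; rewrite wE => /lt_le_trans/(_ (leey _)); rewrite ltxx.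
  apply: nC; exists [set w | (tau w <= s%:E)%E]; last by rewrite /= sE.
  by exists s => //; split=> //; rewrite sE.
apply: GD => //; case: Tt {sG finG GT GC C} => [[r Tr <-]|->]; first exact: Ftau.
rewrite (_ : mkset _ = setT); first exact: measurableT.
by apply/seteqP; split=> // w _; exact: leey.
Qed.

Lemma stopping_atoms_minimal (R : realType) (T : set R) (d : measure_display)
    (Omega : measurableType d) (F : R -> set (set Omega))
    (tau : Omega -> \bar R) :
  is_filtration T F ->
  stopping_atoms T F tau `<=` minimal_elements (stopping_sigma_algebra T F tau).
Proof.
move=> hF A [t Tt [[FA A0 Amin] At]].
split=> //; first exact/(stopping_sigma_algebra_level hF Tt At).
move=> B FB B0 BA; apply: Amin => //.
exact/(stopping_sigma_algebra_level hF Tt (subset_trans BA At)).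
Qed.

Lemma minimal_stopping_atoms (R : realType) (T : set R) (d : measure_display)
    (Omega : measurableType d) (F : R -> set (set Omega))
    (tau : Omega -> \bar R) :
  is_filtration T F -> is_stopping_time T F tau ->
  finite_set (@measurable d Omega) ->
  minimal_elements (stopping_sigma_algebra T F tau) `<=` stopping_atoms T F tau.
Proof.
move=> hF htau finM A [FA A0 Amin].
have [_ FI _ _] := sigma_algebra_set_ops (stopping_sigma_algebraP hF htau).
have /eqP/set0P[w Aw] := A0.
have Tt := htau.1 w.
set t := tau w in Tt.
have Flevel : stopping_sigma_algebra T F tau [set w | tau w = t].
  apply/(stopping_sigma_algebra_level hF Tt (@subset_refl _ _)).
  exact: (extended_filtration_level hF htau Tt finM).
(* The part of [A] in the level set of its point [w] is a nonempty member of the stopping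
   sigma-algebra, so minimality forces it to be all of [A]. *)
have At : A `<=` [set w | tau w = t].
  apply/setIidPl; apply: Amin; [exact: FI| |exact: subIsetl].
  by apply/eqP/set0P; exists w.
exists t => //; split=> //; split=> //.
  exact/(stopping_sigma_algebra_level hF Tt At).
move=> B FB B0 BA; apply: Amin => //.
exact/(stopping_sigma_algebra_level hF Tt (subset_trans BA At)).
Qed.

Theorem theorem1 (R : realType) (T : set R) (d : measure_display)
    (Omega : measurableType d) (P : probability Omega R)
    (F : R -> set (set Omega)) (hF : is_filtration T F)
    (tau : Omega -> \bar R) (htau : is_stopping_time T F tau) :
  stopping_atoms T F tau `<=`
    minimal_elements (stopping_sigma_algebra T F tau) /\
  (finite_set (@measurable d Omega) ->
    [/\ stopping_atoms T F tau =
          minimal_elements (stopping_sigma_algebra T F tau),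
        stopping_sigma_algebra T F tau = <<s stopping_atoms T F tau >> &
        <<s stopping_atoms T F tau >> =
          <<s minimal_elements (stopping_sigma_algebra T F tau) >>]).
Proof.
split=> [|finM]; first exact: stopping_atoms_minimal.
(* Once the two families are identified, all that remains is that a finite sigma-algebra is
   generated by its atoms. *)
have -> : stopping_atoms T F tau =
    minimal_elements (stopping_sigma_algebra T F tau).
  by apply/seteqP; split; [exact: stopping_atoms_minimal|
    exact: minimal_stopping_atoms].
split=> //; apply: finite_sigma_algebra_atoms.
  exact: stopping_sigma_algebraP.
by apply: sub_finite_set finM => A [].
Qed.
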